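(* Let $T:\mathcal H\rightrightarrows\mathcal H$ be maximal monotone and piecewise polyhedral. If $\{z\mid 0\in T(z)\}\neq\emptyset$, then for every fixed splitting $\mathcal H=H_*\oplus H_{**}$, the projected mapping $T_*$ is maximal monotone, and hence the aligned semidefinite proximal scheme for $T$ is implementable relative to the splitting.
   Context: $\mathcal H$ is a finite-dimensional Hilbert space. A splitting is an orthogonal decomposition $\mathcal H=H_*\oplus H_{**}$ into subspaces; each $z\in\mathcal H$ is written $z=(z_*,z_{**})$ with $z_*\in H_*$, $z_{**}\in H_{**}$. A set-valued mapping is piecewise polyhedral if its graph is a union of finitely many polyhedral convex sets. The projected mapping $T_*:H_*\rightrightarrows H_*$ is defined by $$w_*\in T_*(z_* )\iff\exists z_{**}\in H_{**}\text{ such that }(w_*,0)\in T(z_*,z_{**}).$$ A self-adjoint positive semidefinite linear operator $B:\mathcal H\to\mathcal H$ is aligned with the splitting if its range is $H_*$ and its kernel is $H_{**}$. The aligned semidefinite proximal scheme for $T$ is implementable relative to the splitting if, for every $c>0$, every aligned $B$ and every $x\in\mathcal H$, the inclusion $0\in T(z)+c^{-1}B(z-x)$ has at least one solution $z\in\mathcal H$. *)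

(* Defs.v *)
From HB Require Import structures.
From mathcomp Require Import all_boot all_order all_algebra.
From mathcomp Require Import boolp classical_sets reals.

Set Implicit Arguments.
Unset Strict Implicit.
Unset Printing Implicit Defensive.

Import Order.TTheory GRing.Theory Num.Theory.

Local Open Scope classical_set_scope.
Local Open Scope ring_scope.

(* A finite-dimensional real Hilbert space is [H : vectType R] over
   [R : realType] with an inner product of this type; completeness is automatic
   in finite dimension. *)
Notation "{ 'inner' H }" := {dot H for idfun} (format "{ 'inner'  H }").

Section Subspace.
Variables (R : realType) (H : vectType R) (ip : {inner H}) (U : {vspace H}).

Definition sub_inner (u v : subvs_of U) : R := ip (vsval u) (vsval v).

Lemma sub_inner_bilinear :
  bilinear_for (GRing.Scale.Law.clone _ _ *%R _)
    (GRing.Scale.Law.clone _ _ (idfun \; *%R) _) sub_inner.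
Proof.
have vsvalP a (x y : subvs_of U) :
  vsval (a *: x + y) = a *: vsval x + vsval y by exact: linearP.
split=> [u'|u] a x y; rewrite /sub_inner vsvalP.
- by rewrite linearDl linearZl_LR.
- by rewrite linearD linearZ.
Qed.

HB.instance Definition _ := bilinear_isBilinear.Build R
  (subvs_of U) (subvs_of U) R *%R (idfun \; *%R) sub_inner sub_inner_bilinear.

Lemma sub_inner_sym (u v : subvs_of U) :
  sub_inner u v = (-1) ^+ false * idfun (sub_inner v u).
Proof. exact: hermitian_subproof. Qed.

HB.instance Definition _ := isHermitianSesquilinear.Build R
  (subvs_of U) false idfun sub_inner sub_inner_sym.

Lemma sub_inner_gt0 (u : subvs_of U) : u != 0 -> 0 < sub_inner u u.
Proof. by move=> u0; apply: neq0_dnorm_gt0. Qed.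

HB.instance Definition _ := isDotProduct.Build R
  (subvs_of U) sub_inner sub_inner_gt0.

End Subspace.

(* A set-valued mapping from [X] to [Y] is a function [X -> set Y]. *)

Section Monotone.
Variables (R : realType) (H : vectType R) (ip : {inner H}).

Definition monotone (T : H -> set H) : Prop :=
  forall x x' y y', T x y -> T x' y' -> 0 <= ip (x - x') (y - y').

Definition maximal_monotone (T : H -> set H) : Prop :=
  monotone T /\
  forall S : H -> set H, monotone S -> (forall x, T x `<=` S x) -> S = T.

End Monotone.

(* The linear forms may be zero, so that the empty set is always polyhedral;
   taking [m = 0] gives the whole space. *)
Definition polyhedral (R : realType) (E : vectType R) (C : set E) : Prop :=
  exists (m : nat) (f : 'I_m -> {scalar E}) (b : 'I_m -> R),
    C = [set x | forall i, f i x <= b i].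

Definition piecewise_polyhedral (R : realType) (H : vectType R)
    (T : H -> set H) : Prop :=
  exists (n : nat) (C : 'I_n -> set (H * H)),
    (forall i, polyhedral (C i)) /\
    [set p : H * H | T p.1 p.2] = \bigcup_i C i.

Section Splitting.
Variables (R : realType) (H : vectType R) (ip : {inner H}).
Variables (U V : {vspace H}).

(* Directness of the sum follows from orthogonality. *)
Definition splitting : Prop :=
  (U <= orthov ip V)%VS /\ (U + V)%VS = fullv.

(* The pair (z1, z2) of elements of U and V is the vector z1 + z2. *)
Definition projected_mapping (T : H -> set H) : subvs_of U -> set (subvs_of U) :=
  fun z1 => [set w1 | exists z2 : subvs_of V, T (vsval z1 + vsval z2) (vsval w1)].

Definition selfadjoint (B : 'End(H)) : Prop := forall x y, ip (B x) y = ip x (B y).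

Definition possemidef (B : 'End(H)) : Prop := forall x, 0 <= ip (B x) x.

Definition aligned (B : 'End(H)) : Prop :=
  [/\ selfadjoint B, possemidef B, limg B = U & lker B = V].

Definition implementable (T : H -> set H) : Prop :=
  forall (c : R) (B : 'End(H)) (x : H), 0 < c -> aligned B ->
    exists z, [set w + c^-1 *: B (z - x) | w in T z] 0.

End Splitting.

(* Main.v *)
Require Import Defs.
From HB Require Import structures.
From mathcomp Require Import all_boot all_order all_algebra ring lra.
From mathcomp Require Import boolp classical_sets reals.
From mathcomp Require Import interval_inference topology normedtype sequences.

(* For any self-adjoint positive semidefinite [B] and any [x], the inclusion
   [B x - B z \in T z] has a solution [z].  This gives implementability with
   [c^-1 B], and maximality of [T_*] with [B] the orthogonal projection onto
   [Hs], by the easy direction of Minty's theorem.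

   To solve the inclusion, regularize [B] into [B + l I].  By Minty's theorem
   there are [z_l] and [w_l \in T z_l] with [w_l + B z_l + l z_l = B x], and
   monotonicity of [T] against a zero [z0] bounds [l |z_l|^2] independently of
   [l]; hence the residual [w_l + B z_l - B x = - l z_l] tends to [0].  Some
   polyhedral piece of the graph of [T] contains points with arbitrarily small
   residual, and a finite system of linear inequalities which is solvable up to
   every positive error is solvable, even though [z_l] itself may be unbounded.

   Minty's theorem is proved by duality.  The pairs [((x - u) / 2, r)], where
   [(x, u, r)] is a convex combination of triples [(x, u, <x, u>)] from the
   graph, form a convex set on which [- r - |z|^2 <= 0], and a weak limit of a
   maximizing sequence of this concave function is the required point. *)

Set Implicit Arguments.
Unset Strict Implicit.
Unset Printing Implicit Defensive.

Import Order.TTheory GRing.Theory Num.Theory.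
Import numFieldNormedType.Exports.

Local Open Scope classical_set_scope.
Local Open Scope ring_scope.

(** * Finite systems of linear inequalities *)

Section LinearSystem.
Variables (R : realFieldType) (E : lmodType R).

Definition feasible (I : finType) (f : I -> {scalar E}) (b : I -> R) (eps : R)
    (p : E) : Prop := forall i, f i p <= b i + eps.

(** When [f v = 1], this is [g] after the projection onto the kernel of [f] along [v]. *)
Definition reduced_form (f g : {scalar E}) (v q : E) : R := g (q - f q *: v).

Lemma reduced_form_linear f g v : scalar (reduced_form f g v).
Proof.
by move=> a x y; rewrite /reduced_form !(linearD, linearZ, linearB) /=; ring.
Qed.

HB.instance Definition _ f g v :=
  GRing.isLinear.Build R E R *%R
    (reduced_form f g v) (reduced_form_linear f g v).

(* Induction on the number of constraints: if a solution [p] of the remaining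
   constraints violates the first one, then convex combinations of [p] and the
   approximate solutions show that the first constraint may be turned into an
   equality, which is used to eliminate it. *)
Lemma feasible_ord (n : nat) (f : 'I_n -> {scalar E}) (b : 'I_n -> R) :
  (forall eps : R, 0 < eps -> exists p, feasible f b eps p) ->
  exists p, feasible f b 0 p.
Proof.
elim: n f b => [|n IH] f b approx; first by exists 0; case.
pose g i := f (lift ord0 i); pose c i := b (lift ord0 i).
pose f0 := f ord0; pose b0 := b ord0.
have feasE eps p :
    feasible f b eps p <-> f0 p <= b0 + eps /\ feasible g c eps p.
  split=> [fp|[fp0 fp] i]; first by split=> [|i]; apply: fp.
  by case: (unliftP ord0 i) => [j ->|->]; [exact: fp|].
have [|p ps] := IH g c.
  by move=> eps /approx[p /feasE[_ ps]]; exists p.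
have [fp|fp] := leP (f0 p) b0.
  by exists p; apply/feasE; rewrite addr0.
(* Were [f0] zero, [b0] would be negative and small errors infeasible. *)
have [v fv] : exists v, f0 v = 1.
  apply: contrapT => /forallNP nv.
  have fx0 x : f0 x = 0.
    apply: contrapT => /eqP fx; apply: (nv ((f0 x)^-1 *: x)).
    by rewrite linearZ /= mulVf.
  rewrite fx0 in fp.
  have /approx[x /feasE[]] : 0 < - b0 / 2 by lra.
  by rewrite fx0 => ? _; lra.
pose g' i : {scalar E} := reduced_form f0 (g i) v.
pose c' i := c i - b0 * g i v.
have [|q qs] := IH g' c'.
  move=> eps eps0.
  pose K := \sum_i `|g i v|.
  have gK i : `|g i v| <= K.
    by rewrite /K (bigD1 i)//= lerDl sumr_ge0.
  have K0 : 0 <= K by rewrite sumr_ge0.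
  have K1 : 0 < 1 + K by rewrite ltr_pwDl.
  have eps'0 : 0 < eps / (1 + K) by rewrite divr_gt0.
  have [x /feasE[xf xs]] := approx _ eps'0.
  suff [y fy ys] : exists2 y, f0 y = b0 & feasible g c eps y.
    exists y => i.
    rewrite /g' /= /reduced_form fy linearB linearZ /= /c'.
    by have := ys i; lra.
  set e := eps / (1 + K) in eps'0 xf xs.
  have eE : eps = e * (1 + K) by rewrite /e divfK// gt_eqF.
  have eps_e : e <= eps by rewrite eE mulrDr mulr1 lerDl mulr_ge0// ltW.
  (* If [f0 x <= b0], the segment from [x] to [p] meets the hyperplane [f0 = b0]. Otherwise [x] is
     moved there along [v], which adds an error of at most [e * K]. *)
  have [fxb|fxb] := leP (f0 x) b0.
    have fpx : 0 < f0 p - f0 x by lra.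
    pose t := (b0 - f0 x) / (f0 p - f0 x).
    have t0 : 0 <= t by rewrite divr_ge0//; lra.
    have t1 : t <= 1 by rewrite ler_pdivrMr//; lra.
    exists (x + t *: (p - x)).
      by rewrite linearD linearZ linearB /= divfK ?gt_eqF//; ring.
    move=> i; rewrite linearD linearZ linearB /=.
    have := xs i; have := ps i; rewrite addr0; nra.
  exists (x - (f0 x - b0) *: v).
    by rewrite linearB linearZ /= fv; ring.
  move=> i; rewrite linearB linearZ /=.
  have : - ((f0 x - b0) * g i v) <= e * K.
    rewrite (le_trans (ler_norm _))// normrN normrM ler_pM//.
    by rewrite gtr0_norm; lra.
  by have := xs i; rewrite eE; lra.
exists (q - (f0 q - b0) *: v); apply/feasE; split=> [|i].
  by rewrite linearB linearZ /= fv; lra.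
have := qs i; rewrite /g' /c' /= /reduced_form !(linearB (g i)) !scalarZ /=.
lra.
Qed.

Lemma approx_feasible (I : finType) (f : I -> {scalar E}) (b : I -> R) :
  (forall eps : R, 0 < eps -> exists p, feasible f b eps p) ->
  exists p, forall i, f i p <= b i.
Proof.
move=> approx.
have [|p ps] := @feasible_ord #|I| (f \o enum_val) (b \o enum_val).
  by move=> eps /approx[p ps]; exists p => i; apply: ps.
by exists p => i; have := ps (enum_rank i); rewrite /= enum_rankK addr0.
Qed.

End LinearSystem.

(** Lets [t] tend to [0]; one explicit small [t] suffices. *)
Lemma ler_convex_limit (R : realFieldType) (a b c : R) : 0 <= b ->
  (forall t, 0 < t <= 1 -> a + (1 - t) * b <= c) -> a + b <= c.
Proof.
move=> b0 abc; rewrite leNgt; apply/negP => cab.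
pose t := (a + b - c) / (2 * (a + b - c + b)).
have den : 0 < 2 * (a + b - c + b) by lra.
have tE : t * (2 * (a + b - c + b)) = a + b - c by rewrite divfK// gt_eqF.
have t0 : 0 < t by rewrite divr_gt0// subr_gt0.
have t1 : t <= 1 by rewrite ler_pdivrMr//; lra.
have /abc : 0 < t <= 1 by rewrite t0.
by clearbody t; nra.
Qed.

(** * Riesz representation, convex duality and the Debrunner-Flor lemma *)

Section InnerProduct.
Variables (R : realType) (H : vectType R) (ip : {inner H}).

Lemma innerC u v : ip u v = ip v u.
Proof. by rewrite hermC mul1r. Qed.

Lemma innerDl u v w : ip (u + v) w = ip u w + ip v w.
Proof. exact: linearDl. Qed.

Lemma innerNl u v : ip (- u) v = - ip u v.
Proof. exact: linearNl. Qed.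

Lemma innerZl a u v : ip (a *: u) v = a * ip u v.
Proof. exact: linearZl_LR. Qed.

Lemma innerDr u v w : ip u (v + w) = ip u v + ip u w.
Proof. exact: linearD. Qed.

Lemma innerNr u v : ip u (- v) = - ip u v.
Proof. exact: linearN. Qed.

Lemma innerZr a u v : ip u (a *: v) = a * ip u v.
Proof. exact: linearZ. Qed.

Definition innerE := (innerDl, innerDr, innerNl, innerNr, innerZl, innerZr).

Lemma inner_ge0 u : 0 <= ip u u.
Proof.
have [->|u0] := eqVneq u 0; first by rewrite linear0l.
by rewrite ltW// neq0_dnorm_gt0.
Qed.

Lemma inner_eq0 u : ip u u = 0 -> u = 0.
Proof.
have [//|u0] := eqVneq u 0.
by have := neq0_dnorm_gt0 (s:=ip) u u0; rewrite lt0r => /andP[/eqP].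
Qed.

Lemma inner_cauchy_schwarz u v : ip u v ^+ 2 <= ip u u * ip v v.
Proof.
have [/eqP v0|vn0] := boolP (ip v v == 0).
  by rewrite (inner_eq0 v0) !linear0 mulr0 expr0n.
have vv : 0 < ip v v by rewrite lt_neqAle eq_sym vn0 inner_ge0.
have := inner_ge0 (ip v v *: u - ip u v *: v).
rewrite !innerE (innerC v u).
rewrite [leRHS](_ : _ = ip v v * (ip u u * ip v v - ip u v ^+ 2)); last by ring.
by rewrite pmulr_rge0// subr_ge0.
Qed.

Local Notation e := (vbasis {: H}).

Definition gram_map (x : H) : H := \sum_(i < \dim {: H}) ip x e`_i *: e`_i.

Lemma gram_map_linear : linear gram_map.
Proof.
move=> a x y; rewrite /gram_map scaler_sumr -big_split; apply: eq_bigr => i _.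
by rewrite !innerE scalerDl scalerA.
Qed.

HB.instance Definition _ :=
  GRing.isLinear.Build R H H *:%R gram_map gram_map_linear.

(** Definiteness makes [gram_map] injective, hence invertible; the preimage of the vector with
    coordinates [phi e_i] represents [phi]. *)
Lemma riesz (phi : {scalar H}) : exists z, forall v, ip z v = phi v.
Proof.
have efree := basis_free (vbasisP {: H}).
have e_inner x v : ip x v = \sum_(i < \dim {: H}) coord e i v * ip x e`_i.
  rewrite {1}(coord_vbasis (memvf v)) linear_sum; apply: eq_bigr => i _.
  exact: innerZr.
have gram_ker : lker (linfun gram_map) == 0%VS.
  apply/lker0P => x y; rewrite !lfunE => /eqP.
  rewrite -subr_eq0 -linearB => /eqP xy.
  apply/eqP; rewrite -subr_eq0; apply/eqP/inner_eq0.
  rewrite e_inner big1// => i _.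
  by have /freeP/(_ _ xy) -> := efree; rewrite mulr0.
pose w := \sum_(i < \dim {: H}) phi e`_i *: e`_i.
exists ((linfun gram_map)^-1%VF w) => v.
set x := (_ w); have : linfun gram_map x = w by rewrite lker0_lfunVK.
rewrite lfunE /gram_map /w /= => /eqP; rewrite -subr_eq0 -sumrB.
under eq_bigr do rewrite -scalerBl.
move=> /eqP xE; rewrite e_inner {2}(coord_vbasis (memvf v)) linear_sum.
apply: eq_bigr => i _; rewrite linearZ /=; congr (_ * _).
by have /freeP/(_ _ xE)/(_ i)/eqP := efree; rewrite subr_eq0 => /eqP.
Qed.

(* The concave function [- p.2 - ip p.1 p.1] is uniformly concave in [p.1], so
   the first components of a maximizing sequence are Cauchy. *)
Lemma convex_duality (P : set (H * R)) :
  (forall (t : R) p p', 0 <= t <= 1 -> P p -> P p' ->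
     P (t *: p.1 + (1 - t) *: p'.1, t * p.2 + (1 - t) * p'.2)) ->
  (forall p, P p -> 0 <= p.2 + ip p.1 p.1) ->
  exists z, forall p, P p -> ip z z <= 2 * ip z p.1 + p.2.
Proof.
move=> Pconv P0.
have [[p0 Pp0]|P_empty] := pselect (P !=set0); last first.
  by exists 0 => p Pp; exfalso; apply: P_empty; exists p.
pose D (p : H * R) := - (p.2 + ip p.1 p.1).
have D0 p : P p -> D p <= 0 by move=> /P0; rewrite /D oppr_le0.
have D_sup : has_sup (D @` P).
  by split; [exists (D p0), p0|exists 0 => _ [p Pp <-]; exact: D0].
pose s := sup (D @` P).
have Ds p : P p -> D p <= s.
  by move=> Pp; apply: sup_upper_bound => //; exists p.
have s0 : s <= 0.
  by apply: ge_sup => [|_ [p Pp <-]]; [exists (D p0), p0|exact: D0].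
have approx (n : nat) : exists p, P p /\ s - n.+1%:R^-1 <= D p.
  have [|_ [p Pp <-] sp] := @sup_adherent _ (D @` P) n.+1%:R^-1 _ D_sup.
    by rewrite invr_gt0.
  by exists p; rewrite ltW.
have [k /all_and2[Pk kD]] := choice approx.
pose z n := (k n).1.
(* Follows from [D <= s] at the convex combination of [p] and the near-maximizer [k n]; the squared
   distance is the gain from uniform concavity. *)
have key n p (t : R) : P p -> 0 < t <= 1 ->
    D p + (1 - t) * ip (z n - p.1) (z n - p.1) <= s + n.+1%:R^-1 / t.
  move=> Pp /andP[t0 t1].
  have /Ds : P (t *: p.1 + (1 - t) *: (k n).1, t * p.2 + (1 - t) * (k n).2).
    by apply: Pconv => //; rewrite ltW.
  set X := D _; have -> : X = t * D p + (1 - t) * D (k n) +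
      t * ((1 - t) * ip (z n - p.1) (z n - p.1)).
    by rewrite /X /D /z /= !innerE (innerC _ p.1); ring.
  have Dkn := kD n; set e := n.+1%:R^-1 in Dkn *; move=> Xs.
  have et : e / t * t = e by rewrite divfK// gt_eqF.
  have e0 : 0 <= e by rewrite invr_ge0.
  rewrite -(ler_pM2l t0) mulrDr [leRHS]mulrDr [t * (e / t)]mulrC et.
  have : (1 - t) * (s - e) <= (1 - t) * D (k n) by rewrite ler_wpM2l// subr_ge0.
  have : 0 <= t * e by rewrite mulr_ge0// ltW.
  move: Xs {et Dkn}; move: (D p) (D (k n)) (ip _ _) e e0 => d dn Q e e0.
  lra.
(* Take [p = k m] and [t = 1/2] in [key]; the constant is [2 + 4]. *)
have z_cauchy m n : (m <= n)%N -> ip (z n - z m) (z n - z m) <= 6 * m.+1%:R^-1.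
  move=> mn; have /key : P (k m) by [].
  move=> /(_ n 2^-1); rewrite invr_gt0 ltr0n invf_le1 ?ler1n// => /(_ isT).
  have := kD m; rewrite -/(z m) invrK.
  have : n.+1%:R^-1 <= m.+1%:R^-1 :> R by rewrite lef_pV2 ?posrE// ler_nat.
  by move: (n.+1%:R^-1) (m.+1%:R^-1) (ip _ _) (D _) => ? ? ? ?; lra.
have z_cvg v : cvg ((fun n => ip (z n) v) @ \oo).
  apply/cauchy_cvgP/cauchy_exP => e e0.
  pose C := ip v v + 1.
  have C0 : 0 < C by rewrite ltr_wpDl ?inner_ge0.
  have [m me] : exists m, 6 * m.+1%:R^-1 * C < e ^+ 2.
    have d0 : 0 < e ^+ 2 / (6 * C) by rewrite divr_gt0 ?exprn_gt0// mulr_gt0.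
    have [m _ /(_ m (leqnn m)) mlt] := near_infty_natSinv_lt (PosNum d0).
    by exists m; rewrite [6 * _]mulrC -mulrA -ltr_pdivlMr ?mulr_gt0.
  exists (ip (z m) v); exists m => // n /= mn.
  rewrite -ball_normE /= distrC -innerNl -innerDl.
  rewrite -ltr_sqr ?nnegrE ?(ltW e0)// real_normK ?num_real//.
  apply: le_lt_trans me; apply: le_trans (inner_cauchy_schwarz _ _) _.
  apply: ler_pM; rewrite ?inner_ge0//; first exact: z_cauchy.
  by rewrite lerDl.
pose phi v := lim ((fun n => ip (z n) v) @ \oo).
have phi_cvg v : ip (z n) v @[n --> \oo] --> phi v by [].
have phi_lin : scalar phi.
  move=> a v w; apply/cvg_lim => //.
  under eq_fun do rewrite innerDr innerZr.
  by apply: cvgD => //; apply: cvgMr.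
pose phi_scalar := GRing.isLinear.Build R H R *%R phi phi_lin.
have [y yphi] := riesz (HB.pack_for {scalar H} phi phi_scalar).
exists y => p Pp.
have ineq (t : R) : 0 < t <= 1 -> D p + (1 - t) * ip (y - p.1) (y - p.1) <= s.
  move=> t01; have /andP[t0 t1] := t01.
  pose w := y - p.1.
  (* The squared norm of [z n - p.1] is replaced by its affine minorant touching at [y], which
     passes to the weak limit. *)
  pose f n := D p + (1 - t) * (2 * (ip (z n) w - ip p.1 w) - ip w w).
  have : f n @[n --> \oo] -->
      D p + (1 - t) * (2 * (ip y w - ip p.1 w) - ip w w).
    apply: cvgD; first exact: cvg_cst.
    apply: cvgMr; apply: cvgB; last exact: cvg_cst.
    apply: cvgMr; apply: cvgB; last exact: cvg_cst.
    by rewrite yphi.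
  have : s + n.+1%:R^-1 / t @[n --> \oo] --> s + 0 / t.
    apply: cvgD; first exact: cvg_cst.
    by apply: cvgMl; exact: cvg_harmonic.
  move=> gs fs; have := ler_cvg_to fs gs.
  rewrite mul0r addr0 -innerNl -innerDl -/w mulr_natl mulr2n addrK; apply.
  apply: nearW => n; apply: le_trans (key n p t Pp t01).
  rewrite /f lerD2l ler_wpM2l// ?subr_ge0//.
  have := inner_ge0 (z n - p.1 - w).
  rewrite /w !innerE (innerC p.1 y) (innerC (z n) y) (innerC p.1 (z n)); lra.
have DQ := le_trans (ler_convex_limit (inner_ge0 (y - p.1)) ineq) s0.
by move: DQ; rewrite /D !innerE (innerC p.1 y); lra.
Qed.

Lemma inner_basis_eq0 u : (forall i : 'I_(\dim {: H}), ip u e`_i = 0) -> u = 0.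
Proof.
move=> ue; apply: inner_eq0; rewrite {2}(coord_vbasis (memvf u)) linear_sum.
by rewrite big1// => i _; rewrite linearZ /= ue mulr0.
Qed.

(** The convex hull of the triples [(x, u, <x, u>)], generated by binary combinations to allow
    induction. *)
Inductive graph_hull (T : H -> set H) : H -> H -> R -> Prop :=
| graph_hull_graph x u : T x u -> graph_hull T x u (ip x u)
| graph_hull_convex t x u r x' u' r' : 0 <= t <= 1 ->
    graph_hull T x u r -> graph_hull T x' u' r' ->
    graph_hull T (t *: x + (1 - t) *: x') (t *: u + (1 - t) *: u')
      (t * r + (1 - t) * r').

(** The inequality is affine in each triple separately, so two inductions reduce it to two points of
    the graph, where it is monotonicity. *)
Lemma graph_hull_monotone (T : H -> set H) x u r x' u' r' : monotone ip T ->
  graph_hull T x u r -> graph_hull T x' u' r' -> ip x u' + ip x' u <= r + r'.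
Proof.
move=> Tmon h h'; elim: h x' u' r' h' => {x u r}.
  move=> x u Txu x' u' r'; elim=> {x' u' r'}.
    move=> x' u' Txu'; have := Tmon _ _ _ _ Txu Txu'; rewrite !innerE; lra.
  move=> t x1 u1 r1 x2 u2 r2 /andP[t0 t1] _ h1 _ h2; rewrite !innerE.
  have t1' : 0 <= 1 - t by rewrite subr_ge0.
  by have := ler_wpM2l t0 h1; have := ler_wpM2l t1' h2; lra.
move=> t x1 u1 r1 x2 u2 r2 /andP[t0 t1] _ h1 _ h2 x' u' r' h'; rewrite !innerE.
have t1' : 0 <= 1 - t by rewrite subr_ge0.
by have := ler_wpM2l t0 (h1 _ _ _ h'); have := ler_wpM2l t1' (h2 _ _ _ h'); lra.
Qed.

Lemma debrunner_flor (T : H -> set H) : monotone ip T ->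
  exists z, forall x u, T x u -> 0 <= ip (x - z) (u + z).
Proof.
move=> Tmon.
pose P (p : H * R) := exists x u, p.1 = 2^-1 *: (x - u) /\ graph_hull T x u p.2.
have [||z zP] := @convex_duality P.
- move=> t [z r] [z' r'] t01 [x [u [/= -> h]]] [x' [u' [/= -> h']]].
  exists (t *: x + (1 - t) *: x'), (t *: u + (1 - t) *: u'); split.
    rewrite /= !scalerA ![_ * 2^-1]mulrC -!scalerA -scalerDr; congr (_ *: _).
    by rewrite !scalerBr addrACA opprD.
  exact: graph_hull_convex.
(* Pairing the triple with itself gives [<x, u> <= r], so the value is at least [|x + u|^2 / 4]. *)
- move=> [z r] [x [u [/= -> h]]].
  have := graph_hull_monotone Tmon h h.
  by have := inner_ge0 (x + u); rewrite !innerE (innerC u x); lra.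
exists z => x u Txu.
have /zP /= : P (2^-1 *: (x - u), ip x u).
  by exists x, u; split => //; exact: graph_hull_graph.
by rewrite !innerE (innerC z x); lra.
Qed.

End InnerProduct.

(** * Minty's theorem for a positive definite operator *)

Record posdef_operator (R : realType) (H : vectType R) (ip : {inner H}) :=
  PosdefOperator {
  operator :> 'End(H);
  operator_selfadjoint : selfadjoint ip operator;
  operator_gt0 : forall x, x != 0 -> 0 < ip (operator x) x
}.

Section Minty.
Variables (R : realType) (H : vectType R) (ip : {inner H}).
Variable (G : posdef_operator ip).

Definition weighted_inner (x y : H) : R := ip (G x) y.

Lemma weighted_inner_bilinear :
  bilinear_for (GRing.Scale.Law.clone _ _ *%R _)
    (GRing.Scale.Law.clone _ _ (idfun \; *%R) _) weighted_inner.
Proof.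
by split=> [y|x] a u v; rewrite /weighted_inner ?(linearP G) !innerE.
Qed.

HB.instance Definition _ := bilinear_isBilinear.Build R H H R *%R
  (idfun \; *%R) weighted_inner weighted_inner_bilinear.

Lemma weighted_inner_sym (u v : H) :
  weighted_inner u v = (-1) ^+ false * idfun (weighted_inner v u).
Proof. by rewrite /weighted_inner operator_selfadjoint innerC mul1r. Qed.

HB.instance Definition _ := isHermitianSesquilinear.Build R H false idfun
  weighted_inner weighted_inner_sym.

HB.instance Definition _ := isDotProduct.Build R H weighted_inner
  (@operator_gt0 _ _ _ G).

Lemma posdef_operator_surj w : exists u, G u = w.
Proof.
exists ((operator G)^-1%VF w); rewrite lker0_lfunVK//.
apply/lker0P => x y /eqP; rewrite -subr_eq0 -linearB => /eqP Gxy.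
apply/eqP; rewrite -subr_eq0; apply: contraT => /(operator_gt0 G).
by rewrite Gxy linear0l ltxx.
Qed.

(** The mapping [G^-1 (T - y)] is monotone for the inner product weighted by [G]. The Debrunner-Flor
    lemma then yields a point [(z, y - G z)] monotonically related to the graph of [T], which
    contains it by maximality. *)
Lemma minty (T : H -> set H) (y : H) :
  maximal_monotone ip T -> exists z, T z (y - G z).
Proof.
move=> [Tmon Tmax].
pose T' x u := T x (G u + y).
have T'mon : monotone weighted_inner T'.
  move=> x x' u u' /Tmon h /h.
  rewrite opprD addrACA subrr addr0 -linearB.
  by rewrite /= /weighted_inner operator_selfadjoint.
have [z zP] := debrunner_flor T'mon.
have zT x w : T x w -> 0 <= ip (x - z) (w - (y - G z)).
  have [u uE] := posdef_operator_surj (w - y).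
  move=> Txw; have /zP : T' x u by rewrite /T' uE subrK.
  rewrite /= /weighted_inner operator_selfadjoint (linearD G) /= uE.
  by rewrite opprB addrA [w - y + _]addrAC -addrA.
exists z; pose S x w := T x w \/ x = z /\ w = y - G z.
suff /Tmax <- : monotone ip S by [move=> x w; left|right].
move=> x x' w w' [Txw|[-> ->]] [Txw'|[-> ->]].
- exact: Tmon.
- exact: zT.
- by rewrite -(opprB x') -(opprB w') innerNl innerNr opprK; exact: zT.
- by rewrite subrr linear0l.
Qed.

End Minty.

(** * Solving the proximal inclusion by regularization *)

Section SemidefiniteProximal.
Variables (R : realType) (H : vectType R) (ip : {inner H}) (T : H -> set H).
Variable (B : 'End(H)).
Hypotheses (Bsa : selfadjoint ip B) (Bpos : possemidef ip B).
Local Notation e := (vbasis {: H}).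

Lemma regularized_posdef (l : R) : 0 < l ->
  exists G : posdef_operator ip, forall x, G x = B x + l *: x.
Proof.
move=> l0; pose G : 'End(H) := (B + l *: \1%VF).
have GE x : G x = B x + l *: x by rewrite !(add_lfunE, scale_lfunE, id_lfunE).
have Gsa : selfadjoint ip G by move=> x y; rewrite !GE !innerE Bsa.
have Gpos x : x != 0 -> 0 < ip (G x) x.
  move=> x0; rewrite GE !innerE ltr_wpDl ?Bpos// mulr_gt0//.
  exact: neq0_dnorm_gt0.
by exists (PosdefOperator Gsa Gpos).
Qed.

Lemma regularized_bound (z0 x z w : H) (l : R) : monotone ip T ->
  T z0 0 -> T z w -> w = B x - (B z + l *: z) -> 0 < l <= 1 ->
  l * ip z z <= ip (B (x - z0)) (x - z0) / 2 + ip z0 z0.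
Proof.
move=> Tmon T0 Tw wE /andP[l0 l1].
have := Tmon _ _ _ _ Tw T0; rewrite wE subr0.
(* Bounds <z - z0, B (x - z0)> - <z - z0, B (z - z0)> above by
   <x - z0, B (x - z0)> / 4. *)
have := Bpos (2^-1 *: (x - z0) - (z - z0)).
have lz := ler_wpM2r (inner_ge0 ip z0) l1.
(* Bounds the cross term [l <z, z0>] by half of [l |z|^2 + l |z0|^2]. *)
have := mulr_ge0 (ltW l0) (inner_ge0 ip (z - z0)).
rewrite !(linearB B) linearZ /= !(linearB B) !innerE.
have Bsym u v : ip (B u) v = ip (B v) u by rewrite Bsa innerC.
rewrite -!Bsa (Bsym x z) (Bsym x z0) (Bsym z0 z) (innerC ip z0 z).
lra.
Qed.

Lemma approx_solution (x : H) (n : nat) (v : 'I_n -> H) (eps : R) :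
  maximal_monotone ip T -> [set z | T z 0] !=set0 -> 0 < eps ->
  exists z w, T z w /\ forall i, `|ip (w + B z - B x) (v i)| <= eps.
Proof.
move=> Tmax [z0 T0] eps0.
pose M := ip (B (x - z0)) (x - z0) / 2 + ip z0 z0.
have M0 : 0 <= M by rewrite addr_ge0 ?inner_ge0// divr_ge0// Bpos.
pose N := \sum_i ip (v i) (v i).
have N0 : 0 <= N by rewrite sumr_ge0// => i _; exact: inner_ge0.
have MN : 0 < 1 + M * N by rewrite ltr_pwDl// mulr_ge0.
(* By Cauchy-Schwarz, the squared residual against [v i] is at most [l * (M * N)]; the summand [1]
   keeps the denominator positive. *)
pose l := Num.min 1 (eps ^+ 2 / (1 + M * N)).
have l0 : 0 < l by rewrite lt_min ltr01 divr_gt0// exprn_gt0.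
have l1 : l <= 1 by rewrite ge_min lexx.
have lMN : l * (M * N) <= eps ^+ 2.
  have : l * (1 + M * N) <= eps ^+ 2.
    by rewrite -ler_pdivlMr// ge_min lexx orbT.
  by rewrite mulrDr; apply: le_trans; rewrite lerDr mulr1 ltW.
have [G GE] := regularized_posdef l0.
have [z Tz] := minty G (B x) Tmax.
rewrite GE in Tz.
have lz : l * ip z z <= M.
  have l01 : 0 < l <= 1 by rewrite l0.
  exact: regularized_bound Tmax.1 T0 Tz erefl l01.
exists z, (B x - (B z + l *: z)); split => // i.
have -> : B x - (B z + l *: z) + B z - B x = - (l *: z).
  by rewrite opprD addrA (addrAC _ (- (l *: z)) (B z)) subrK addrAC subrr add0r.
rewrite innerNl innerZl normrN -ler_sqr ?nnegrE ?(ltW eps0)//.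
rewrite real_normK ?num_real// exprMn.
apply: le_trans lMN; rewrite expr2 -mulrA ler_pM2l//.
apply: (@le_trans _ _ (l * (ip z z * ip (v i) (v i)))).
  by rewrite ler_pM2l// inner_cauchy_schwarz.
rewrite mulrA ler_pM ?inner_ge0//; first by rewrite mulr_ge0 ?inner_ge0// ltW.
by rewrite /N (bigD1 i)//= lerDl sumr_ge0// => j _; exact: inner_ge0.
Qed.

Definition residual_form (v : H) (p : H * H) : R := ip (p.2 + B p.1) v.

Lemma residual_form_linear v : scalar (residual_form v).
Proof.
move=> a p q; rewrite /residual_form /= (linearP B) !innerE; ring.
Qed.

HB.instance Definition _ v := GRing.isLinear.Build R (H * H)%type R *%R
  (residual_form v) (residual_form_linear v).

Lemma semidefinite_proximal_step (x : H) :
  maximal_monotone ip T -> piecewise_polyhedral T -> [set z | T z 0] !=set0 ->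
  exists z, T z (B x - B z).
Proof.
move=> Tmax [n [C [Cpoly TC]]] T0.
(* Basis vectors and their opposites, so that one-sided inequalities encode an equation. *)
pose v (j : 'I_(\dim {: H} + \dim {: H})) : H :=
  match split j with inl k => e`_k | inr k => - e`_k end.
(* Otherwise each piece fails at some error, and an approximate solution for the least of these
   errors lies in no piece. *)
have [i Ci] : exists i, forall eps : R, 0 < eps -> exists2 p, C i p &
    forall j, `|ip (p.2 + B p.1 - B x) (v j)| <= eps.
  apply: contrapT => /forallNP noC.
  have bad i : exists eps : R, 0 < eps /\ forall p, C i p ->
      exists j, eps < `|ip (p.2 + B p.1 - B x) (v j)|.
    have /existsNP[eps /not_implyP[eps0 nop]] := noC i.
    exists eps; split => // p Cp; apply: contrapT => /forallNP noj.
    by apply: nop; exists p => // j; rewrite leNgt; apply/negP.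
  have [eps /all_and2[eps0 epsC]] := choice bad.
  pose d := \big[Num.min/1]_i eps i.
  have d0 : 0 < d.
    by rewrite /d; elim/big_ind: _ => // a b a0 b0; rewrite lt_min a0.
  have [z [w [Tzw zw]]] := approx_solution x v Tmax T0 d0.
  have [i _ Ci] : (\bigcup_i C i) (z, w) by rewrite -TC.
  have [j] := epsC i _ Ci; rewrite ltNge => /negP; apply.
  by rewrite (le_trans (zw j))// /d; exact: bigmin_le.
have [m [f [b CE]]] := Cpoly i.
pose F (k : 'I_m + 'I_(\dim {: H} + \dim {: H})) : {scalar (H * H)%type} :=
  match k with inl a => f a | inr j => residual_form (v j) end.
pose c (k : 'I_m + 'I_(\dim {: H} + \dim {: H})) : R :=
  match k with inl a => b a | inr j => ip (B x) (v j) end.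
have [|[z w] zw] := @approx_feasible _ _ _ F c.
  move=> eps eps0; have [p Cp pv] := Ci _ eps0.
  exists p => -[a|j] /=.
    by move: Cp; rewrite CE => /(_ a) /le_trans; apply; rewrite lerDl ltW.
  rewrite /residual_form -lerBlDl -innerNl -innerDl.
  exact: le_trans (ler_norm _) (pv j).
exists z.
have -> : B x - B z = w.
  apply/eqP; rewrite subr_eq -subr_eq0.
  apply/eqP/(@inner_basis_eq0 _ _ ip) => k.
  apply/eqP; rewrite innerDl innerNl subr_eq0 eq_le.
  have vl : v (lshift _ k) = e`_k.
    by rewrite /v -[lshift _ k]/(unsplit (inl k)) unsplitK.
  have vr : v (rshift _ k) = - e`_k.
    by rewrite /v -[rshift _ k]/(unsplit (inr k)) unsplitK.
  have := zw (inr (lshift _ k)); have := zw (inr (rshift _ k)).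
  by rewrite /= /residual_form vl vr !innerNr lerN2 => -> ->.
suff : [set p : H * H | T p.1 p.2] (z, w) by [].
by rewrite TC; exists i => //; rewrite CE => a; exact: (zw (inl a)).
Qed.

End SemidefiniteProximal.

(** For [(x, w)] in a monotone extension, solve [x + w - z \in T z]; monotonicity gives
    [- |x - z|^2 >= 0], so [z = x]. *)
Lemma minty_converse (R : realType) (H : vectType R) (ip : {inner H})
    (T : H -> set H) :
  monotone ip T -> (forall y, exists z, T z (y - z)) -> maximal_monotone ip T.
Proof.
move=> Tmon Tsurj; split=> // S Smon TS.
apply/funext => x; apply/seteqP; split; last exact: TS.
move=> w Sxw; have [z Tz] := Tsurj (x + w).
have := Smon _ _ _ _ Sxw (TS _ _ Tz).
have -> : w - (x + w - z) = - (x - z).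
  by rewrite opprB opprD addrCA [w + _]addrCA subrr addr0 opprB.
rewrite innerNr oppr_ge0 => xz.
have /inner_eq0/eqP : ip (x - z) (x - z) = 0.
  by apply/le_anti; rewrite xz inner_ge0.
by rewrite subr_eq0 => /eqP xzE; move: Tz; rewrite -xzE addrAC subrr add0r.
Qed.

(** * Orthogonal splittings and the projected mapping *)

Section OrthogonalProjection.
Variables (R : realType) (H : vectType R) (ip : {inner H}) (U V : {vspace H}).
Hypothesis UV : splitting ip U V.

Lemma splitting_orthogonal u v : u \in U -> v \in V -> ip u v = 0.
Proof. by move=> uU vV; have /orthovP := UV.1; apply. Qed.

Lemma splitting_direct : (U :&: V = 0)%VS.
Proof.
apply/eqP; rewrite -subv0; apply/subvP => u; rewrite memv_cap => /andP[uU uV].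
by rewrite memv0; apply/eqP/(@inner_eq0 _ _ ip)/splitting_orthogonal.
Qed.

Lemma splitting_proj_add x : daddv_pi U V x + daddv_pi V U x = x.
Proof. by rewrite daddv_pi_add ?splitting_direct// UV.2 memvf. Qed.

Lemma splitting_proj_inner x y :
  ip (daddv_pi U V x) y = ip (daddv_pi U V x) (daddv_pi U V y).
Proof.
rewrite -{1}(splitting_proj_add y) innerDr.
by rewrite [X in _ + X]splitting_orthogonal ?memv_pi ?addr0.
Qed.

Lemma splitting_proj_selfadjoint : selfadjoint ip (daddv_pi U V).
Proof.
by move=> x y; rewrite splitting_proj_inner innerC -splitting_proj_inner innerC.
Qed.

Lemma splitting_proj_possemidef : possemidef ip (daddv_pi U V).
Proof. by move=> x; rewrite splitting_proj_inner inner_ge0. Qed.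

End OrthogonalProjection.

Theorem corollary3p3 (R : realType) (H : vectType R) (ip : {inner H})
    (T : H -> set H) :
  maximal_monotone ip T -> piecewise_polyhedral T ->
  [set z | T z 0] !=set0 ->
  forall Hs Hss : {vspace H}, splitting ip Hs Hss ->
    maximal_monotone (@sub_inner R H ip Hs) (projected_mapping Hss T) /\
    implementable ip Hs Hss T.
Proof.
move=> Tmax Tpoly T0 Hs Hss split_H; split; last first.
  move=> c B x c0 [Bsa Bpos _ _].
  pose B' : 'End(H) := c^-1 *: B.
  have B'E z : B' z = c^-1 *: B z by rewrite scale_lfunE.
  have B'sa : selfadjoint ip B' by move=> u v; rewrite !B'E !innerE Bsa.
  have B'pos : possemidef ip B'.
    by move=> u; rewrite B'E innerZl mulr_ge0// invr_ge0 ltW.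
  have [z Tz] := semidefinite_proximal_step B'sa B'pos x Tmax Tpoly T0.
  exists z, (B' x - B' z) => //.
  by rewrite linearB scalerBr -!B'E addrA subrK subrr.
apply: minty_converse.
  move=> z z' w w' [u Tu] [u' Tu'].
  have := Tmax.1 _ _ _ _ Tu Tu'.
  (* The [Hss] components contribute nothing because [w - w'] lies in [Hs]. *)
  rewrite opprD addrACA innerDl [X in _ + X](_ : _ = 0) ?addr0.
    by rewrite -!linearB.
  by rewrite innerC (splitting_orthogonal split_H)// -linearB subvsP.
move=> y.
(* With the projection onto [Hs] as [B], the value [y - z_*] lies in [Hs], and the [Hss] part of [z]
   witnesses that it belongs to [T_*] at [z_*]. *)
have [z Tz] := semidefinite_proximal_step (splitting_proj_selfadjoint split_H)
  (splitting_proj_possemidef split_H) (vsval y) Tmax Tpoly T0.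
exists (vsproj Hs (daddv_pi Hs Hss z)), (vsproj Hss (daddv_pi Hss Hs z)).
rewrite linearB /= !vsprojK ?memv_pi// (splitting_proj_add split_H).
by rewrite (daddv_pi_id (splitting_direct split_H) (subvsP y)) in Tz.
Qed.
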